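(* Let $\varphi$ be a map from the positive integers to the nonnegative integers and let $n\ge0$. Let $\mathcal{A}_\varphi(n)$ be the set of partitions of $n$ in which, for every $i>0$, the part $i$ appears at most $2\varphi(i)+1$ times, and let $\mathcal{B}_\varphi(n)$ be the set of partitions of $n$ in which, for every $i>0$, the part $2i$ appears at most $\varphi(i)$ times. For $i\ge1$ and $k,t\ge0$ let $P(n,\varphi,i,k,t)$ be the set of $\alpha\in\mathcal{A}_\varphi(n)$ such that $i$ appears in $\alpha$ at most $2\varphi(i)+1$ times, $l_a(\alpha)=k$ and $q(\alpha)=t$; and let $Q(n,\varphi,i,k,t)$ be the set of $\beta\in\mathcal{B}_\varphi(n)$ such that $2i$ appears in $\beta$ at most $\varphi(i)$ times, $l_o(\beta)=k$ and $l_o(\beta)+(p(\beta)-1)/2=t$. Then for all $i\ge1$ and $k,t\ge0$ there exists a bijection between $P(n,\varphi,i,k,t)$ and $Q(n,\varphi,i,k,t)$.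
   Context: For a partition $\lambda=(\lambda_1\ge\lambda_2\ge\cdots\ge\lambda_r>0)$: $l_a(\lambda)=\lambda_1-\lambda_2+\lambda_3-\cdots$ is its alternating sum; $l_o(\lambda)$ is its number of odd parts counted with multiplicity; $p(\lambda)$ is its largest odd part; $q(\lambda)$ is its largest part having odd multiplicity. Conventions: $q(\alpha)=0$ if no part of $\alpha$ has odd multiplicity, and the quantity $l_o(\beta)+(p(\beta)-1)/2$ is taken to be $0$ if $\beta$ has no odd parts. *)

(* Defs.v *)
From mathcomp Require Import all_boot all_order all_algebra.
From mathcomp Require Import classical_sets functions.

Set Implicit Arguments.
Unset Strict Implicit.
Unset Printing Implicit Defensive.

Local Open Scope classical_set_scope.

Definition is_partition (n : nat) (s : seq nat) : bool :=
  [&& sorted geq s, 0 \notin s & sumn s == n].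

Definition alternating_sum (s : seq nat) : int :=
  (\sum_(i < size s) (-1) ^+ i * (nth 0%N s i)%:Z)%R.

Definition num_odd_parts (s : seq nat) : nat := count odd s.

(* Equal to 0 when there is no odd part. *)
Definition largest_odd_part (s : seq nat) : nat := \max_(x <- s | odd x) x.

(* Equal to 0 when no part has odd multiplicity. *)
Definition largest_part_odd_mult (s : seq nat) : nat :=
  \max_(x <- s | odd (count_mem x s)) x.

(* l_o + (p - 1) / 2, with value 0 when there is no odd part; p is odd
   otherwise, so the halving is exact. *)
Definition lo_plus_half (s : seq nat) : nat :=
  if has odd s then num_odd_parts s + (largest_odd_part s - 1)./2 else 0.

(* phi is only ever evaluated at positive integers. *)
Definition A_set (phi : nat -> nat) (n : nat) : set (seq nat) :=
  [set s | is_partition n s /\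
           forall i, 0 < i -> count_mem i s <= 2 * phi i + 1].

Definition B_set (phi : nat -> nat) (n : nat) : set (seq nat) :=
  [set s | is_partition n s /\
           forall i, 0 < i -> count_mem (2 * i) s <= phi i].

Definition P_set (n : nat) (phi : nat -> nat) (i k t : nat) : set (seq nat) :=
  [set a | [/\ A_set phi n a, count_mem i a <= 2 * phi i + 1,
               alternating_sum a = k%:Z%R & largest_part_odd_mult a = t]].

Definition Q_set (n : nat) (phi : nat -> nat) (i k t : nat) : set (seq nat) :=
  [set b | [/\ B_set phi n b, count_mem (2 * i) b <= phi i,
               num_odd_parts b = k & lo_plus_half b = t]].

(* Main.v *)
Require Import Defs.
From mathcomp Require Import all_boot all_order all_algebra.
From mathcomp Require Import classical_sets functions.
From mathcomp Require Import zify.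

(** Splitting every multiplicity as [2 m + e] with [e <= 1] writes a partition
    [alpha] as a partition into distinct parts plus two copies of a partition
    [mu]; cancelling equal neighbours shows that the alternating sum only sees
    the distinct part.  Dually [beta] splits into its odd parts and the doubled
    parts of a partition [mu], and in both cases the bound on multiplicities
    says that [i] occurs at most [phi i] times in [mu].  It remains to match
    partitions into distinct parts with partitions into odd parts, and
    Sylvester's fish-hook bijection does so while sending the alternating sum
    to the number of parts and the largest part to
    [l_o + (p - 1) / 2]. *)

(** * Sylvester's bijection from strict partitions to odd partitions *)

Definition strict_partition (d : seq nat) : bool := sorted gtn d && (0 \notin d).

Definition odd_partition (w : seq nat) : bool := sorted geq w && all odd w.

(* The first two fish-hooks of an odd partition [2a+1 :: w] have sizes
   [x = a + size w + 1] and [y = a + #|parts > 2 of w|]; erasing them leaves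
   the parts of [w] that exceed 2, each lowered by 2.  This is the
   inverse of that step. *)
Fixpoint sylvester (d : seq nat) : seq nat :=
  match d with
  | [::] => [::]
  | [:: x] => nseq x 1
  | [:: x, y & s] =>
      let w := sylvester s in
      (y - size w).*2.+1 :: map (addn 2) w ++ nseq (x - y).-1 1
  end.

Lemma gtn_transitive : transitive gtn.
Proof. by move=> y x z /= xy yz; apply: ltn_trans yz xy. Qed.

Lemma geq_transitive : transitive geq.
Proof. by move=> y x z /= xy yz; apply: leq_trans yz xy. Qed.

Lemma geq_antisymmetric : antisymmetric geq.
Proof. by move=> x y /= xy; apply/eqP; rewrite eqn_leq andbC. Qed.

Lemma geq_total : total geq.
Proof. by move=> x y; apply: leq_total. Qed.

Lemma sorted_geq_eq (s1 s2 : seq nat) :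
  sorted geq s1 -> sorted geq s2 -> perm_eq s1 s2 -> s1 = s2.
Proof. exact: sorted_eq geq_transitive geq_antisymmetric s1 s2. Qed.

Lemma sorted_gtn_geq (s : seq nat) : sorted gtn s -> sorted geq s.
Proof. by apply: sub_sorted => x y /= /ltnW. Qed.

Lemma strict_partition_cons (x : nat) (d : seq nat) :
  strict_partition (x :: d) = (head 0 d < x) && strict_partition d.
Proof.
rewrite /strict_partition; case: d => [|y d] /=; first by rewrite inE; lia.
by rewrite !inE; case: (0 \in d); case: path => //=; lia.
Qed.

Lemma sorted_geq_le_head (a : nat) (w : seq nat) :
  sorted geq w -> all (geq (head a w)) w.
Proof.
case: w => //= x w; rewrite path_sortedE; last exact: geq_transitive.
by rewrite leqnn /= => /andP[].
Qed.

Lemma sorted_head_bigmax (s : seq nat) :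
  sorted geq s -> \max_(x <- s) x = head 0 s.
Proof.
elim: s => [|x s IH] /=; first by rewrite big_nil.
move=> p; rewrite big_cons IH ?(path_sorted p) //.
by case: s p {IH} => [|y s] /=; lia.
Qed.

(** Induction removes two parts at a time. The last clause says that the first fish-hook has the
    size of the largest part; the default [1] gives the empty partition a hook of size 0. Applied to
    [s], it yields [size w + (head 1 w)./2 < y], so the truncated [y - size w] is exact and the new
    head dominates the shifted parts. *)
Lemma sylvesterP (d : seq nat) : strict_partition d ->
  [/\ odd_partition (sylvester d), sumn (sylvester d) = sumn d
    & size (sylvester d) + (head 1 (sylvester d))./2 = head 0 d].
Proof.
have [m] := ubnP (size d); elim: m d => // m IH [|x [|y s]] //= szd.
  rewrite strict_partition_cons /= => _; split.
  - rewrite /odd_partition; apply/andP; split; last by rewrite all_nseq orbT.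
    by case: x => //= x; elim: x => //= x ->.
  - by rewrite sumn_nseq mul1n addn0.
  - by rewrite size_nseq; case: x => //= x; rewrite addn0.
rewrite !strict_partition_cons /= => /and3P[yx sy sd].
have {IH} [|] := IH s _ sd; first by lia.
set w := sylvester s => /andP[sw ow] sumw hw.
have ohd : odd (head 1 w) by case: (w) ow => //= ? ? /andP[].
have lew := sorted_geq_le_head 1 _ sw.
have mapE : sumn (map (addn 2) w) = sumn w + (size w).*2.
  by elim: (w) => //= z v ->; lia.
split; last by rewrite /= size_cat size_map size_nseq; lia.
- rewrite /odd_partition /= odd_double all_cat all_map all_nseq orbT andbT.
  have -> /= : all (preim (addn 2) odd) w.
    by apply: sub_all ow => z oz /=; rewrite negbK.
  rewrite andbT path_sortedE; last exact: geq_transitive.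
  rewrite all_cat all_map !all_nseq sorted_pairwise; last exact: geq_transitive.
  rewrite pairwise_cat pairwise_map.
  have -> /= : pairwise (relpre (addn 2) geq) w.
    rewrite sorted_pairwise in sw; last exact: geq_transitive.
    by apply: sub_pairwise sw => u v /=; rewrite leq_add2l.
  rewrite orbT !andbT; apply/and3P; split.
  + by apply: sub_all lew => z /=; lia.
  + apply/allrelP => u v /mapP[z _ ->] /nseqP[-> _] /=; lia.
  + by elim: _.-1 => //= j ->; rewrite all_nseq orbT.
- by rewrite sumn_cat mapE sumn_nseq; lia.
Qed.

Lemma alternating_sum_cons (x : nat) (s : seq nat) :
  alternating_sum (x :: s) = (x%:Z - alternating_sum s)%R.
Proof.
rewrite /alternating_sum big_ord_recl /= GRing.expr0 GRing.mul1r.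
congr (_ + _)%R; rewrite -GRing.sumrN; apply: eq_bigr => i _.
by rewrite GRing.exprS GRing.mulN1r GRing.mulNr.
Qed.

(** A step adds the new head and [x - y - 1] ones, hence [x - y] parts, which is what the pair
    [x, y] contributes to the alternating sum. *)
Lemma size_sylvester (d : seq nat) : strict_partition d ->
  ((size (sylvester d))%:Z)%R = alternating_sum d.
Proof.
have [m] := ubnP (size d); elim: m d => // m IH [|x [|y s]] //= szd.
- by rewrite /alternating_sum big_ord0.
- by rewrite alternating_sum_cons /alternating_sum big_ord0 size_nseq GRing.subr0.
rewrite !strict_partition_cons /= => /and3P[yx sy sd].
rewrite !alternating_sum_cons -IH //; last by lia.
by rewrite size_cat size_map size_nseq; lia.
Qed.

(** Shifted odd parts are at least 3, so they can be told apart from the padding by ones. *)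
Lemma filter_gt2_shift (w : seq nat) (k : nat) : all odd w ->
  [seq x <- map (addn 2) w ++ nseq k 1 | 2 < x] = map (addn 2) w.
Proof.
rewrite filter_cat [X in _ ++ X]filter_nseq /= cats0.
by elim: w => //= x w IH /andP[ox ow]; rewrite IH // ifT //; lia.
Qed.

(** The first hook determines the largest part; the parts above 2 after the head determine the image
    of the partition stripped of its two largest parts, and the head then determines [y]. *)
Lemma sylvester_inj (d1 d2 : seq nat) :
  strict_partition d1 -> strict_partition d2 ->
  sylvester d1 = sylvester d2 -> d1 = d2.
Proof.
have [m] := ubnP (size d1); elim: m d1 d2 => // m IH d1 d2 szd sd1 sd2 E.
have [_ _] := sylvesterP _ sd1; have [_ _] := sylvesterP _ sd2.
rewrite E => -> {}hE.
case: d1 d2 hE szd sd1 sd2 E => [|x [|y s]] [|x' [|y' s']] //= hx szd;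
  rewrite !strict_partition_cons //=; try (by lia); rewrite {}hx //.
(* A single part yields only ones, whereas [size (sylvester s') < y'] forces a first part of at
   least 3. *)
- move=> /andP[x0 _] /and3P[_ sy' sd'].
  have [_ _] := sylvesterP _ sd'; case: x szd x0 => //= ? _ _ + []; lia.
- move=> /and3P[_ sy sd] /andP[x0 _].
  have [_ _] := sylvesterP _ sd; case: x szd x0 => //= ? _ _ + []; lia.
move=> /and3P[yx sy sd] /and3P[yx' sy' sd'] [E1 E2].
have [/andP[_ ow] _ hw] := sylvesterP _ sd.
have [/andP[_ ow'] _ hw'] := sylvesterP _ sd'.
have Ew : sylvester s = sylvester s'.
  apply: (inj_map (@addnI 2)).
  by rewrite -(filter_gt2_shift _ (x - y).-1 ow) E2 filter_gt2_shift.
rewrite Ew in E1 hw; rewrite (IH s s') //; last by lia.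
by congr [:: _, _ & _]; lia.
Qed.

Lemma odd_partition_shift (w : seq nat) : odd_partition w ->
  exists k (w' : seq nat),
    odd_partition w' /\ w = map (addn 2) w' ++ nseq k 1.
Proof.
elim: w => [|x w IH]; first by exists 0, [::].
rewrite /odd_partition /= => /andP[p /andP[ox ow]].
have sw := path_sorted p.
have [|k [w' [/andP[sw' ow'] Ew]]] := IH; first by rewrite /odd_partition sw.
have [x1|x1] := eqVneq x 1.
  exists (size w).+1, [::]; split=> //=; rewrite x1; congr (_ :: _).
  apply/all_pred1P/allP => z zw /=.
  move: p; rewrite path_sortedE; last exact: geq_transitive.
  case/andP => /allP/(_ z zw) /= ? _; have := allP ow z zw; lia.
exists k, (x - 2 :: w'); split; last by rewrite /= -Ew; congr (_ :: _); lia.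
rewrite /= ow' andbT; apply/andP; split; last by lia.
rewrite path_sortedE ?sw' ?andbT; last exact: geq_transitive.
apply/allP => z zw' /=; move: p.
rewrite Ew path_sortedE; last exact: geq_transitive.
rewrite all_cat all_map => /andP[/andP[/allP/(_ z zw') /= ? _] _]; lia.
Qed.

Lemma sylvester_surj (w : seq nat) : odd_partition w ->
  exists2 d, strict_partition d & sylvester d = w.
Proof.
have [m] := ubnP (size w); elim: m w => // m IH [|a w] /=; first by exists [::].
move=> szw /andP[/= p /andP[oa ow]]; have sw := path_sorted p.
move: p; rewrite path_sortedE; last exact: geq_transitive.
case/andP => lea _.
have [a1|a1] := eqVneq a 1.
  exists [:: (size w).+1] => //=; rewrite a1; congr (_ :: _).
  apply/esym/all_pred1P/allP => z zw /=.
  by have := allP lea z zw; have := allP ow z zw; rewrite /=; lia.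
have [|k [w' [ow' Ew]]] := odd_partition_shift w; first by rewrite /odd_partition sw.
have [|d sd Ed] := IH w' _ ow'.
  by move: szw; rewrite Ew size_cat size_map; lia.
have [_ _] := sylvesterP _ sd; rewrite Ed => hd.
(* By [hd] this is the inequality [head 0 d < y] for the second hook size [y] chosen below. If [w']
   is empty it reads [0 < a./2], which holds since [a] is odd and not 1. *)
have hw' : (head 1 w')./2 < a./2.
  case: (w') Ew ow' => [|z v] /= Ew; first by lia.
  by move=> /andP[_ /= /andP[]]; move: lea; rewrite Ew /=; lia.
(* These solve [y - size w' = a./2] and [(x - y).-1 = k]. *)
exists [:: a./2 + size w' + k.+1, a./2 + size w' & d].
  by rewrite !strict_partition_cons /= sd -hd andbT; lia.
rewrite /= Ed Ew addnK; congr (_ :: _ ++ nseq _ _); lia.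
Qed.

(** * Splitting a partition into a strict part and pairs of equal parts *)

(* Only meaningful on sorted sequences, where equal parts are adjacent. *)
Fixpoint odd_mult_parts (s : seq nat) : seq nat :=
  if s is x :: s' then
    let d := odd_mult_parts s' in
    if ohead d == Some x then behead d else x :: d
  else [::].

Fixpoint paired_parts (s : seq nat) : seq nat :=
  if s is x :: s' then
    if ohead (odd_mult_parts s') == Some x then x :: paired_parts s'
    else paired_parts s'
  else [::].

Lemma perm_odd_paired (s : seq nat) :
  perm_eq s (odd_mult_parts s ++ paired_parts s ++ paired_parts s).
Proof.
apply/permP => P; rewrite !count_cat; elim: s => //= x s ->.
case: (odd_mult_parts s) => [|y d] /=; first by lia.
by case: (Some y =P Some x) => [[->]|_] /=; lia.
Qed.

(** A cancelled pair contributes [x - x] and leaves the signs of the later parts unchanged. *)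
Lemma alternating_sum_odd_mult_parts (s : seq nat) :
  alternating_sum (odd_mult_parts s) = alternating_sum s.
Proof.
elim: s => //= x s IH; rewrite alternating_sum_cons -IH.
case: (odd_mult_parts s) => [|y d] /=; first by rewrite alternating_sum_cons.
by case: (Some y =P Some x) => [[->]|_]; rewrite !alternating_sum_cons //; lia.
Qed.

Lemma odd_mult_parts_strict (s : seq nat) :
  sorted geq s -> 0 \notin s -> strict_partition (odd_mult_parts s).
Proof.
have sub : {subset odd_mult_parts s <= s}.
  by move=> x xd; rewrite (perm_mem (perm_odd_paired s)) mem_cat xd.
move=> ss s0; rewrite /strict_partition (contra (@sub 0) s0) andbT {s0 sub}.
elim: s ss => //= x s IH p; have := IH (path_sorted p).
have sub : {subset odd_mult_parts s <= s}.
  by move=> y yd; rewrite (perm_mem (perm_odd_paired s)) mem_cat yd.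
case: (odd_mult_parts s) sub => [|y d] //= sub pd.
case: (Some y =P Some x) => [_|/eqP ne]; first exact: path_sorted pd.
rewrite /= pd andbT; move: p; rewrite path_sortedE; last exact: geq_transitive.
case/andP => /allP/(_ y) + _; rewrite sub ?inE ?eqxx // => /(_ isT) /=.
by move: ne; rewrite -[Some y == _]/(y == x); lia.
Qed.

Lemma strict_partition_uniq (d : seq nat) : strict_partition d -> uniq d.
Proof.
case/andP => sd _; apply: sorted_uniq sd; first exact: gtn_transitive.
by move=> x; rewrite /= ltnn.
Qed.

(** The multiplicity of each part is 0 or 1 from [d] plus twice that in [m], so its parity
    determines [d] and its half determines [m]. *)
Lemma strict_double_unique (s d m : seq nat) :
  sorted geq s -> 0 \notin s -> strict_partition d -> perm_eq s (d ++ m ++ m) ->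
  odd_mult_parts s = d /\ perm_eq (paired_parts s) m.
Proof.
move=> ss s0 sd /permP psd.
have so := odd_mult_parts_strict _ ss s0.
have [uo ud] := (strict_partition_uniq _ so, strict_partition_uniq _ sd).
have cE x : (x \in odd_mult_parts s) = (x \in d) /\
    count_mem x (paired_parts s) = count_mem x m.
  have := permP (perm_odd_paired s) (pred1 x).
  rewrite psd !count_cat (count_uniq_mem _ uo) (count_uniq_mem _ ud).
  by case: (x \in d); case: (x \in odd_mult_parts s); lia.
split; last by apply/allP => x _; apply/eqP; case: (cE x).
move/andP: so => [so _]; move/andP: sd => [sd _].
apply: sorted_geq_eq; try exact: sorted_gtn_geq.
by apply: uniq_perm => // x; case: (cE x).
Qed.

Lemma largest_part_odd_multE (s : seq nat) : sorted geq s -> 0 \notin s ->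
  largest_part_odd_mult s = head 0 (odd_mult_parts s).
Proof.
move=> ss s0; have so := odd_mult_parts_strict _ ss s0.
have uo := strict_partition_uniq _ so; case/andP: so => so _.
rewrite -sorted_head_bigmax; last exact: sorted_gtn_geq.
rewrite /largest_part_odd_mult -big_filter.
(* The left side may repeat a part; idempotence of the maximum leaves only an equality of sets of
   parts. *)
apply: eq_big_idem; first exact: maxnn.
move=> x; rewrite mem_filter.
have /permP/(_ (pred1 x)) := perm_odd_paired s.
rewrite !count_cat (count_uniq_mem _ uo) => cE.
rewrite (perm_mem (perm_odd_paired s)) !mem_cat cE.
by case: (x \in odd_mult_parts s) => //=; lia.
Qed.

(** The default [1] has half 0, in accordance with the convention for no odd parts; for odd [p],
    [(p - 1)./2] is [p./2]. *)
Lemma lo_plus_halfE (s : seq nat) (w := [seq x <- s | odd x]) : sorted geq s ->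
  lo_plus_half s = size w + (head 1 w)./2.
Proof.
move=> ss; rewrite /lo_plus_half /num_odd_parts /largest_odd_part -size_filter.
have sw : sorted geq w by apply: sorted_filter ss; exact: geq_transitive.
rewrite -big_filter sorted_head_bigmax // has_filter -/w.
have ow : all odd w by exact: filter_all.
by case: (w) ow => //= x v; lia.
Qed.

(** * Merging odd parts with doubled parts *)

Definition merge_odd_double (w m : seq nat) : seq nat :=
  sort geq (w ++ map double m).

Lemma filter_odd_merge (w m : seq nat) : odd_partition w ->
  [seq x <- merge_odd_double w m | odd x] = w.
Proof.
move=> /andP[sw ow]; apply: sorted_geq_eq => //.
  apply: sorted_filter; first exact: geq_transitive.
  exact: sort_sorted geq_total _.
apply: perm_trans (_ : perm_eq [seq x <- w ++ map double m | odd x] w).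
  by apply: perm_filter; rewrite perm_sort.
rewrite filter_cat (all_filterP ow).
have -> : [seq x <- map double m | odd x] = [::].
  by elim: m => //= x m ->; rewrite odd_double.
by rewrite cats0.
Qed.

Lemma count_double_merge (w m : seq nat) (i : nat) : all odd w ->
  count_mem (2 * i) (merge_odd_double w m) = count_mem i m.
Proof.
move=> ow; rewrite /merge_odd_double count_sort count_cat count_map.
rewrite (eq_in_count (a2 := pred0)) ?count_pred0 ?add0n.
  by apply: eq_count => x /=; lia.
by move=> x xw /=; have := allP ow x xw; lia.
Qed.

Lemma sumn_map_double (m : seq nat) : sumn (map double m) = (sumn m).*2.
Proof. by elim: m => //= x m ->; rewrite doubleD. Qed.

(** * The composite map and its bijectivity *)

Definition sylvester_double (s : seq nat) : seq nat :=
  merge_odd_double (sylvester (odd_mult_parts s)) (paired_parts s).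

Lemma count_paired_le (s : seq nat) (i c : nat) : sorted geq s -> 0 \notin s ->
  (count_mem i s <= 2 * c + 1) = (count_mem i (paired_parts s) <= c).
Proof.
move=> ss s0; have uo := strict_partition_uniq _ (odd_mult_parts_strict _ ss s0).
have /permP/(_ (pred1 i)) -> := perm_odd_paired s.
by rewrite !count_cat (count_uniq_mem _ uo); case: (_ \in _); lia.
Qed.

(** Each defining condition transports separately. The forward direction shows that the map lands in
    [Q_set], the backward one that the preimage built for surjectivity lies in [P_set]. *)
Lemma sylvester_doubleP (phi : nat -> nat) (n i k t : nat) (s : seq nat) :
  0 < i -> sorted geq s -> 0 \notin s ->
  P_set n phi i k t s <-> Q_set n phi i k t (sylvester_double s).
Proof.
move=> i0 ss s0; have so := odd_mult_parts_strict _ ss s0.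
have [ow sumw hw] := sylvesterP _ so; have szw := size_sylvester _ so.
have := ow => /andP[_ aw].
have cE j : count_mem (2 * j) (sylvester_double s) = count_mem j (paired_parts s).
  exact: count_double_merge.
have sb : sorted geq (sylvester_double s) by exact: sort_sorted geq_total _.
have s0' : 0 \notin sylvester_double s.
  rewrite mem_sort mem_cat negb_or; apply/andP; split.
    by apply/negP => /(allP aw).
  apply/negP => /mapP[x xp x2]; have {x2} x2 : x = 0 by lia.
  by move: s0; rewrite (perm_mem (perm_odd_paired s)) !mem_cat -x2 xp !orbT.
have sumE : sumn (sylvester_double s) = sumn s.
  rewrite (perm_sumn (perm_odd_paired s)) !sumn_cat addnn -sumw -sumn_map_double.
  by rewrite -sumn_cat; apply: perm_sumn; rewrite perm_sort.
have oE : num_odd_parts (sylvester_double s) = size (sylvester (odd_mult_parts s)).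
  by rewrite /num_odd_parts -size_filter filter_odd_merge.
have hE : lo_plus_half (sylvester_double s) = largest_part_odd_mult s.
  by rewrite lo_plus_halfE // filter_odd_merge // largest_part_odd_multE.
have aE : (alternating_sum s = k%:Z)%R <-> num_odd_parts (sylvester_double s) = k.
  by rewrite oE -alternating_sum_odd_mult_parts -szw; split => [[]|->].
have bE j : (count_mem j s <= 2 * phi j + 1) =
    (count_mem (2 * j) (sylvester_double s) <= phi j).
  by rewrite cE count_paired_le.
rewrite /P_set /Q_set /A_set /B_set /= /is_partition ss s0 sb s0' sumE hE bE.
split=> -[[H1 H2] H3 H4 H5]; split=> //; try exact/aE;
  by split=> // j /H2; rewrite bE.
Qed.

Theorem theorem4p1 (phi : nat -> nat) (n : nat) (i k t : nat) (hi : 0 < i) :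
  exists f : seq nat -> seq nat, set_bij (P_set n phi i k t) (Q_set n phi i k t) f.
Proof.
exists sylvester_double.
have part s : P_set n phi i k t s -> sorted geq s /\ 0 \notin s.
  by case=> -[/and3P[-> ->]].
split.
- by move=> s Ps; have [ss s0] := part s Ps; apply/sylvester_doubleP.
- move=> s1 s2 /set_mem/part[ss1 s01] /set_mem/part[ss2 s02] E.
  have so1 := odd_mult_parts_strict _ ss1 s01.
  have so2 := odd_mult_parts_strict _ ss2 s02.
  have [ow1 _ _] := sylvesterP _ so1; have [ow2 _ _] := sylvesterP _ so2.
  (* The odd parts of the image determine the strict part, and the multiplicities of its even parts
     determine the pairs. *)
  have Eo : odd_mult_parts s1 = odd_mult_parts s2.
    apply: sylvester_inj => //.
    rewrite -(filter_odd_merge _ (paired_parts s1) ow1) -/(sylvester_double _) E.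
    exact: filter_odd_merge.
  have Ep : perm_eq (paired_parts s1) (paired_parts s2).
    apply/allP => x _; apply/eqP.
    have [/andP[_ aw1] /andP[_ aw2]] := (ow1, ow2).
    rewrite -(count_double_merge _ _ x aw1) -/(sylvester_double _) E.
    exact: count_double_merge.
  apply: sorted_geq_eq => //; apply: perm_trans (perm_odd_paired s1) _.
  rewrite perm_sym; apply: perm_trans (perm_odd_paired s2) _.
  by rewrite Eo perm_cat2l perm_sym perm_cat.
- move=> b Qb; have [[/and3P[sb b0 _] _] _ _ _] := Qb.
  have ow : odd_partition [seq x <- b | odd x].
    rewrite /odd_partition filter_all andbT.
    by apply: sorted_filter sb; exact: geq_transitive.
  have [d sd Ed] := sylvester_surj _ ow.
  pose m := map half [seq x <- b | ~~ odd x].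
  have Em : map double m = [seq x <- b | ~~ odd x].
    rewrite -map_comp -[RHS]map_id; apply/eq_in_map => x.
    rewrite mem_filter /= => /andP[ox _]; exact: even_halfK.
  (* The preimage joins the strict partition behind the odd parts of [b] to two copies of its halved
     even parts. *)
  pose s := sort geq (d ++ m ++ m).
  have ss : sorted geq s by exact: sort_sorted geq_total _.
  have m0 : 0 \notin m.
    apply/negP => /(map_f double); rewrite Em mem_filter /= => b0'.
    by rewrite b0' in b0.
  have s0 : 0 \notin s.
    by rewrite mem_sort !mem_cat !negb_or m0 !andbT; case/andP: sd.
  have ps : perm_eq s (d ++ m ++ m) by rewrite perm_sort.
  have [Eo Ep] := strict_double_unique _ _ _ ss s0 sd ps.
  have Eb : sylvester_double s = b.
    apply: sorted_geq_eq => //; first exact: sort_sorted geq_total _.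
    rewrite perm_sort Eo Ed.
    apply: perm_trans (_ : perm_eq ([seq x <- b | odd x] ++ map double m) b).
      by rewrite perm_cat2l perm_map.
    by rewrite Em; apply/permEl/perm_filterC.
  by exists s => //; apply/sylvester_doubleP => //; rewrite Eb.
Qed.
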